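(* Let $\Gamma$ be a finite collection of finite sets with $|\Gamma|\ge 2$. Assume there is a positive integer $\beta$ such that $e(\Gamma-\{S\})=\beta$ for every $S\in\Gamma$. Then there is an integer $m$ such that for every $S\in\Gamma$, $$\Big|S-\bigcup(\Gamma-\{S\})\Big|-\Big|\bigcap(\Gamma-\{S\})-S\Big|=m.$$ If, in addition, for some (equivalently, for each) $S\in\Gamma$ the collection $\Gamma-\{S\}$ is a KE collection, then $m=0$ if and only if $\Gamma$ is a KE collection.
   Context: For a finite nonempty collection $\Gamma$ of finite sets, $e(\Gamma)=|\bigcup\Gamma|+|\bigcap\Gamma|$. A relevant collection is a finite collection $F$ of finite sets all having the same cardinality, a positive integer denoted $\alpha(F)$. A relevant collection $F$ is a Konig–Egervary (KE) collection if $|\bigcup F|+|\bigcap F|=2\alpha(F)$.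
   Formalization: The ''for some S'' version and the equivalence ''for some (equivalently, for each) S'' are stated only for Γ whose members all have the same positive cardinality, as both can fail otherwise; the ''for each S'' version needs no such assumption. *)

(* Defs.v *)
From mathcomp Require Import all_boot all_order all_algebra finmap.

Set Implicit Arguments.
Unset Strict Implicit.
Unset Printing Implicit Defensive.

Local Open Scope fset_scope.

(* The union of a collection [G] is finmap's [fcover G].
   For a nonempty collection this is the intersection of its members; on the
   empty collection, whose intersection is undefined, it returns [fset0]. *)
Definition finter (K : choiceType) (G : {fset {fset K}}) : {fset K} :=
  [fset x in fcover G | all (fun S : {fset K} => x \in S) G].

Lemma in_finter (K : choiceType) (G : {fset {fset K}}) (x : K) :
  G != fset0 -> x \in finter G <-> (forall S, S \in G -> x \in S).
Proof.
move=> /fset0Pn [S0 S0G]; rewrite !inE /=; split.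
  by move=> /andP[_ /allP allG] S SG; exact: allG.
move=> inG; apply/andP; split; last by apply/allP=> S SG; apply: inG.
by apply/bigfcupP; exists S0; rewrite ?S0G ?inG.
Qed.

Definition esize (K : choiceType) (G : {fset {fset K}}) : nat :=
  (#|` fcover G| + #|` finter G|)%N.

(* [F] is relevant with alpha(F) = [a]. [F] is required to be nonempty, as
   otherwise alpha(F) is not determined. *)
Definition is_alpha (K : choiceType) (F : {fset {fset K}}) (a : nat) : Prop :=
  [/\ F != fset0, (0 < a)%N & forall S, S \in F -> #|` S| = a].

Definition relevant (K : choiceType) (F : {fset {fset K}}) : Prop :=
  exists a, is_alpha F a.

Definition KE (K : choiceType) (F : {fset {fset K}}) : Prop :=
  exists2 a, is_alpha F a & esize F = (2 * a)%N.

(* Main.v *)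
(* Adding S back to G \ S enlarges the union by S \ U(G \ S) and shrinks the
   intersection by I(G \ S) \ S, so the difference of these cardinalities is
   e(G) - e(G \ S); the constant m is therefore e(G) - beta. When the G \ S are
   KE, beta is twice the common cardinality of the members of G. *)
Require Import Defs.
From mathcomp Require Import all_boot all_order all_algebra finmap zify.

Local Open Scope fset_scope.

Set Implicit Arguments.
Unset Strict Implicit.

Lemma cardfsD1_neq0 (K : choiceType) (G : {fset K}) (S : K) :
  (2 <= #|` G|)%N -> G `\ S != fset0.
Proof. by rewrite -cardfs_gt0 (cardfsD1 S G); case: (S \in G) => /=; lia. Qed.

Lemma fcoverD1 (K : choiceType) (G : {fset {fset K}}) (S : {fset K}) :
  S \in G -> fcover G = fcover (G `\ S) `|` S.
Proof. by move=> SG; rewrite /fcover (big_fsetD1 S) //= fsetUC. Qed.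

Lemma finterD1 (K : choiceType) (G : {fset {fset K}}) (S : {fset K}) :
  S \in G -> G `\ S != fset0 -> finter G = finter (G `\ S) `&` S.
Proof.
move=> SG GS0; have G0 : G != fset0 by apply/fset0Pn; exists S.
apply/fsetP=> x; rewrite in_fsetI; apply/idP/andP.
  move=> /(in_finter _ G0) xG; split; last exact: xG.
  by apply/(in_finter _ GS0) => T /fsetD1P[_ TG]; exact: xG.
case=> /(in_finter _ GS0) xGS xS; apply/(in_finter _ G0) => T TG.
by have [->//|TS] := eqVneq T S; apply: xGS; apply/fsetD1P.
Qed.

(** Written additively to avoid truncated subtraction in [nat]. *)
Lemma esizeD1 (K : choiceType) (G : {fset {fset K}}) (S : {fset K}) :
  S \in G -> G `\ S != fset0 ->
  (esize G + #|` finter (G `\ S) `\` S|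
     = esize (G `\ S) + #|` S `\` fcover (G `\ S)|)%N.
Proof.
move=> SG GS0; rewrite /esize (finterD1 SG GS0) (fcoverD1 SG).
have := cardfsID S (finter (G `\ S)).
have := cardfsUI (fcover (G `\ S)) S.
(* [fsetIC] gives this intersection the same form as in [cardfsUI], so that [lia] treats both as one
   unknown. *)
have := cardfsID (fcover (G `\ S)) S; rewrite fsetIC.
lia.
Qed.

Lemma is_alphaD1 (K : choiceType) (G : {fset {fset K}}) (S : {fset K}) a :
  is_alpha G a -> G `\ S != fset0 -> is_alpha (G `\ S) a.
Proof. by case=> _ a_gt0 Ga GS0; split=> // T /fsetD1P[_ /Ga]. Qed.

Lemma is_alpha_inj (K : choiceType) (F : {fset {fset K}}) a b :
  is_alpha F a -> is_alpha F b -> a = b.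
Proof. by case=> /fset0Pn[S SF] _ Fa [_ _ Fb]; rewrite -(Fa S SF) Fb. Qed.

Lemma KE_esize (K : choiceType) (F : {fset {fset K}}) a :
  is_alpha F a -> KE F <-> esize F = (2 * a)%N.
Proof.
move=> Fa; split=> [[b Fb ->]|eF]; last by exists a.
by rewrite (is_alpha_inj Fa Fb).
Qed.

(** Each [G]\ S [comes with its own cardinality, but twice that number is
    always]beta[, so all of them agree. Since]G[has at least two members, every]T[survives in some]
    G [\ U] and so has this cardinality. *)
Lemma is_alpha_KE_D1 (K : choiceType) (G : {fset {fset K}}) (beta : nat) :
  (2 <= #|` G|)%N -> (forall S, S \in G -> esize (G `\ S) = beta) ->
  (forall S, S \in G -> KE (G `\ S)) ->
  exists2 a, is_alpha G a & beta = (2 * a)%N.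
Proof.
move=> G_ge2 e_beta KE_G.
have G0 : G != fset0 by rewrite -cardfs_gt0; lia.
have [S SG] := fset0Pn _ G0; have [a [_ a_gt0 _] eS] := KE_G S SG.
have beta_a : beta = (2 * a)%N by rewrite -(e_beta S SG).
exists a => //; split=> // T TG.
have [U /fsetD1P[UT UG]] := fset0Pn _ (cardfsD1_neq0 T G_ge2).
have [b [_ _ Ub] eU] := KE_G U UG.
have -> : #|` T| = b by apply: Ub; apply/fsetD1P; rewrite eq_sym.
by move: (e_beta U UG); lia.
Qed.

Unset Implicit Arguments.

Theorem theorem2p1 (K : choiceType) (G : {fset {fset K}}) (beta : nat)
    (G_ge2 : (2 <= #|` G|)%N) (beta_gt0 : (0 < beta)%N)
    (e_beta : forall S, S \in G -> esize (G `\ S) = beta) :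
  exists m : int,
    [/\ forall S, S \in G ->
          ((#|` S `\` fcover (G `\ S)|)%:Z
             - (#|` finter (G `\ S) `\` S|)%:Z)%R = m,
        (forall S, S \in G -> KE (G `\ S)) -> (m = 0%R <-> KE G),
        relevant G ->
          ((exists2 S, S \in G & KE (G `\ S))
             <-> (forall S, S \in G -> KE (G `\ S)))
      & relevant G ->
          (exists2 S, S \in G & KE (G `\ S)) -> (m = 0%R <-> KE G)].
Proof.
have GS0 S := cardfsD1_neq0 S G_ge2.
have KE_iff : (forall S, S \in G -> KE (G `\ S)) ->
    (((esize G)%:Z - beta%:Z)%R = 0%R <-> KE G).
  move=> /(is_alpha_KE_D1 G_ge2 e_beta)[a Ga ->].
  by rewrite (KE_esize Ga); lia.
have KE_all : relevant G -> (exists2 S, S \in G & KE (G `\ S)) ->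
    forall S, S \in G -> KE (G `\ S).
  move=> [a Ga] [S SG KE_S] T TG.
  apply/(KE_esize (is_alphaD1 Ga (GS0 T))); rewrite (e_beta T TG) -(e_beta S SG).
  exact/(KE_esize (is_alphaD1 Ga (GS0 S))).
exists ((esize G)%:Z - beta%:Z)%R; split=> //.
- by move=> S SG; move: (esizeD1 SG (GS0 S)); rewrite (e_beta S SG); lia.
- move=> relG; split; first exact: KE_all.
  (* Passing from all [S] to some [S] requires a member of [G]. *)
  have [S SG] : exists S, S \in G.
    by apply/fset0Pn; rewrite -cardfs_gt0; lia.
  by move=> KE_G; exists S => //; exact: KE_G.
- by move=> relG /(KE_all relG); exact: KE_iff.
Qed.
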